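(* Fix a constant $\Lambda>1$. For any $\varepsilon>0$ there is a mapping $f:[0,1]^2\to\mathbb{R}$ with $\Theta^{*1}(f,x)=\Theta_*^1(f,x)=|J^1f|(x)=1$ for almost every $x\in[0,1]^2$ such that the following holds: for any measurable set $K\subset[0,1]^2$ and any $\Lambda$-bi-Lipschitz homeomorphism $G:\mathbb{R}^2\to\mathbb{R}^2$ such that $(f\circ G^{-1})|_{(\mathbb{R}\times\{y\})\cap G(K)}$ is $\Lambda$-bi-Lipschitz (onto its image) for any $y\in\mathbb{R}$, we have $\mathcal{H}^2(K)<\varepsilon$.
   Context: $\mathcal{H}^2$ on $\mathbb{R}^2$ is Lebesgue measure. $\omega_1=2$ is the length of the unit ball in $\mathbb{R}$. The Hausdorff content of $E\subset\mathbb{R}$ is $\mathcal{H}^1_\infty(E)=\inf\frac{\omega_1}{2}\sum_{i=1}^\infty\operatorname{diam}A_i$, the infimum being over all countable coverings $E\subset\bigcup_{i=1}^\infty A_i$. For $A=[0,1]^2$, $f:A\to\mathbb{R}$ and $x\in A$, the upper and lower $1$-densities of $f$ at $x$ are $$ \Theta^{*1}(f,x)=\limsup_{r\to0}\frac{\mathcal{H}^1_\infty(f(B(x,r)\cap A))}{\omega_1 r},\qquad \Theta_*^{1}(f,x)=\liminf_{r\to0}\frac{\mathcal{H}^1_\infty(f(B(x,r)\cap A))}{\omega_1 r}. $$ The Jacobian at a point of differentiability is $|J^1f|(x)=\sqrt{\det\big(Df(x)\,Df(x)^T\big)}$, i.e. $|J^1f|(x)=|\nabla f(x)|$. A homeomorphism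 $g:(Y,\sigma)\to(Z,\rho)$ is $\Lambda$-bi-Lipschitz if $\Lambda^{-1}\sigma(a,b)\le\rho(g(a),g(b))\le\Lambda\sigma(a,b)$ for all $a,b\in Y$. *)

(* Defs.v *)
From mathcomp Require Import all_boot all_order all_algebra.
From mathcomp Require Import all_classical all_reals all_analysis.
Import Order.TTheory GRing.Theory Num.Theory.
Import numFieldTopology.Exports numFieldNormedType.Exports.

Set Implicit Arguments.
Unset Strict Implicit.
Unset Printing Implicit Defensive.

Local Open Scope classical_set_scope.
Local Open Scope ring_scope.

Section EuclideanPlane.
Variable R : realType.

(* The library norm on R * R is the sup norm, hence this explicit distance.
   The product topology, the differential and the null sets are those of the
   Euclidean plane. *)
Definition eucl_dist (p q : R * R) : R :=
  Num.sqrt ((p.1 - q.1) ^+ 2 + (p.2 - q.2) ^+ 2).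

Definition rdist (a b : R) : R := `|a - b|.

Definition eball (x : R * R) (r : R) : set (R * R) := [set y | eucl_dist x y < r].

Definition unit_square : set (R * R) := `[0, 1] `*` `[0, 1].

Definition horizontal_line (y : R) : set (R * R) := setT `*` [set y].

Definition lebesgue2 := ((@lebesgue_measure R) \x (@lebesgue_measure R))%E.

(* lebesgue2 lives on the Borel sets; its outer extension and the associated
   Caratheodory sigma-algebra give H^2 on all Lebesgue measurable sets. *)
Definition H2 (K : set (R * R)) : \bar R := mu_ext lebesgue2 K.

Definition lebesgue2_measurable (K : set (R * R)) : Prop :=
  (mu_ext lebesgue2).-caratheodory K.

End EuclideanPlane.

Section Densities.
Variable R : realType.

Definition omega1 : R := 2.

(* The supremum with 0 makes diam set0 = 0, as ereal_sup set0 = -oo. *)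
Definition diam (A : set R) : \bar R :=
  ereal_sup (0%E |` [set (rdist a b)%:E | a in A & b in A]).

Definition hausdorff_content1 (E : set R) : \bar R :=
  ereal_inf [set ((omega1 / 2)%:E * \sum_(0 <= i <oo) diam (A i))%E
            | A in [set A : (set R)^nat | E `<=` \bigcup_i A i]].

(* Maps on the unit square are represented by total functions; only their
   values on the square are used. *)
Definition density_ratio (f : R * R -> R) (x : R * R) (r : R) : \bar R :=
  (hausdorff_content1 (f @` (eball x r `&` @unit_square R))
   * ((omega1 * r)^-1)%:E)%E.

Definition upper_density (f : R * R -> R) (x : R * R) : \bar R :=
  limf_esup (density_ratio f x) 0^'+.

Definition lower_density (f : R * R -> R) (x : R * R) : \bar R :=
  limf_einf (density_ratio f x) 0^'+.

Definition deriv_mx (f : R * R -> R) (x : R * R) : 'M[R]_(1, 2) :=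
  \matrix_(i < 1, j < 2) 'd f x (if j == 0 then (1, 0) else (0, 1)).

Definition jac1 (f : R * R -> R) (x : R * R) : R :=
  Num.sqrt (\det (deriv_mx f x *m (deriv_mx f x)^T)).

End Densities.

Section BiLipschitz.
Variables (R : realType) (Y Z : topologicalType).

Definition homeomorphism (A : set Y) (B : set Z) (g : Y -> Z) : Prop :=
  [/\ set_bij A B g,
      {within A, continuous g} &
      exists h : Z -> Y, {in A, cancel g h} /\ {within B, continuous h}].

(* s and t are to be distances inducing the topologies of Y and Z. *)
Definition bilipschitz_homeo (L : R) (s : Y -> Y -> R) (t : Z -> Z -> R)
    (A : set Y) (B : set Z) (g : Y -> Z) : Prop :=
  homeomorphism A B g /\
  forall a b, A a -> A b -> L^-1 * s a b <= t (g a) (g b) <= L * s a b.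

End BiLipschitz.

(* Main.v *)
Require Import Defs.
From mathcomp Require Import all_boot all_order all_algebra.
From mathcomp Require Import all_classical all_reals all_analysis.
From mathcomp Require Import measurable_realfun.
From mathcomp Require Import ring lra.
Import Order.TTheory GRing.Theory Num.Theory.
Import numFieldTopology.Exports numFieldNormedType.Exports.

Local Open Scope classical_set_scope.
Local Open Scope ring_scope.

(** The map [f] folds the square along vertical lines at a tiny scale:
    [f x = triangle_wave (n * x.1) / n], a sawtooth of slope 1 or -1 whose whole
    image lies in an interval of length [d = 1 / (2 n)].

    Off the countably many creases, [f] is locally [x |-> c + s * x.1] with
    [s ^+ 2 = 1].  So its gradient has norm 1, and it maps a small disc of
    radius [r] onto an open interval of length [2 r], whose Hausdorff content is
    [2 r] (hausdorff_content1_itv); both densities are thus 1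
    (locally_affine_densities).  Creases and sides of the square form a null set
    (ae_off_lines).

    Suppose now that [f] composed with the inverse of [G] is bi-Lipschitz on
    every horizontal slice of [G @` K].  Since [f] takes values in an interval of
    length [d], each slice has diameter at most [Lambda * d]: the set [G @` K]
    has very thin slices, hence by Fubini a small area, and so has [K].
    Measurability of [K] is essential here, for a set with one point on each
    horizontal line can have full outer measure.  It enters through the
    approximation of [K] by a compact subset [C] (caratheodory_inner_compact).

    For compact [C], Fubini and the change of variables are both replaced by a
    count of small squares.  By compactness, the bound on the slices of [G @` C]
    survives on horizontal strips of some positive height [h]
    (compact_slices_uniform).  Cut [G @` C] into about [2 M / h] such strips,
    where [M] bounds its height, and every strip, of width at most [2 w] with
    [w = 2 * Lambda * d], into about [2 w / h] squares of side [h].  The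
    preimage of each square has diameter at most a multiple of [Lambda * h], so
    its area is of order [h ^+ 2]; the factors [h] cancel in the total
    (H2_thin_slices), which is of order [d] and is small when [n] is large. *)

(** * Hausdorff content of intervals *)

Lemma diam_ge0 {R : realType} (A : set R) : (0 <= diam A)%E.
Proof. by apply: ereal_sup_ubound; left. Qed.

Lemma diam0 {R : realType} : diam (@set0 R) = 0%E.
Proof.
rewrite /diam (_ : [set _ | _ in _ & _ in _] = set0).
  by rewrite setU0 ereal_sup1.
by apply/seteqP; split=> // y [? []].
Qed.

(** The interval from [inf A] to [sup A], except when [A] is empty or
    unbounded. Enlarging the members of a covering in this way makes the
    countable subadditivity of Lebesgue measure bound contents from below. *)
Lemma measurable_envelope {R : realType} (A : set R) :
  exists B : set R,
    [/\ measurable B, A `<=` B & (lebesgue_measure B <= diam A)%E].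
Proof.
have [->|/set0P[a Aa]] := eqVneq A set0.
  by exists set0; split=> //; rewrite measure0 diam_ge0.
case dA : (diam A) (diam_ge0 A) => [d||] // d0; last first.
  by exists setT; split=> //; rewrite leey.
have Ad x y : A x -> A y -> x - y <= d.
  move=> Ax Ay; apply: le_trans (ler_norm _) _.
  rewrite -lee_fin -dA; apply: ereal_sup_ubound; right.
  by exists x => //; exists y.
have supA : has_sup A.
  by split; [exists a|exists (a + d) => x Ax; rewrite -lerBlDl Ad].
have infA : has_inf A.
  by split; [exists a|exists (a - d) => x Ax; rewrite lerBlDl -lerBlDr Ad].
exists `[inf A, sup A]%classic; split=> //.
  by move=> x Ax /=; rewrite in_itv /= (ge_inf infA.2) ?(ub_le_sup supA.2).
rewrite lebesgue_measure_itv /= lte_fin; case: ifPn => _; last by rewrite lee_fin.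
rewrite -EFinB lee_fin lerBlDr; apply: ge_sup => [|x Ax]; first by exists a.
rewrite -lerBlDl; apply: lb_le_inf => [|y Ay]; first by exists a.
by rewrite lerBlDr -lerBlDl Ad.
Qed.

(** The interval covers itself, which gives one inequality; Lebesgue measure
    gives the other. *)
Lemma hausdorff_content1_itv {R : realType} (a b : R) : a <= b ->
  hausdorff_content1 `]a, b[%classic = (b - a)%:E.
Proof.
move=> ab.
have om : (omega1 R / 2)%:E = 1%E by rewrite /omega1 divff.
apply/eqP; rewrite eq_le; apply/andP; split.
  apply: ge_ereal_inf.
  exists (\sum_(0 <= i <oo) diam (if i is 0%N then `]a, b[%classic else set0))%E.
    exists (fun i => if i is 0%N then `]a, b[%classic else set0).
      by move=> x abx; exists 0%N.
    by rewrite om mul1e.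
  rewrite (nneseries_recl _) //; last by move=> k _; exact: diam_ge0.
  rewrite eseries0 ?adde0; last by case=> // i _ _; exact: diam0.
  apply: ge_ereal_sup => _ [->|[x xab [y yab <-]]]; rewrite lee_fin.
    by rewrite subr_ge0.
  move: xab yab; rewrite /= !in_itv /= /rdist => /andP[? ?] /andP[? ?].
  by rewrite ler_norml; apply/andP; split; lra.
apply: le_ereal_inf_tmp => _ [A abA <-]; rewrite om mul1e.
have /choice[B hB] := fun i => measurable_envelope (A i).
have -> : (b - a)%:E = lebesgue_measure `]a, b[%classic.
  rewrite lebesgue_measure_itv /= lte_fin; case: ltgtP ab => // -> _.
  by rewrite subrr.
apply: (@le_trans _ _ (\sum_(0 <= i <oo) lebesgue_measure (B i))%E).
  apply: measure_sigma_subadditive => // [i|x /abA[i _ Ax]].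
    by case: (hB i).
  by exists i => //; case: (hB i) => _ AB _; exact: AB.
by apply: lee_nneseries => [i _ _|i _]; [exact: measure_ge0|case: (hB i)].
Qed.

(** * Euclidean distance and balls *)

Lemma fst_le_eucl {R : realType} (p q : R * R) : `|p.1 - q.1| <= eucl_dist p q.
Proof. by rewrite -sqrtr_sqr; apply: ler_wsqrtr; rewrite lerDl sqr_ge0. Qed.

Lemma snd_le_eucl {R : realType} (p q : R * R) : `|p.2 - q.2| <= eucl_dist p q.
Proof. by rewrite -sqrtr_sqr; apply: ler_wsqrtr; rewrite lerDr sqr_ge0. Qed.

Lemma eucl_le_add {R : realType} (p q : R * R) :
  eucl_dist p q <= `|p.1 - q.1| + `|p.2 - q.2|.
Proof.
rewrite -(@ger0_norm _ (`|p.1 - q.1| + `|p.2 - q.2|)) ?addr_ge0//.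
rewrite -sqrtr_sqr; apply: ler_wsqrtr.
rewrite [leRHS]sqrrD !real_normK ?num_real// lerD2r lerDl.
by rewrite mulrn_wge0 // mulr_ge0.
Qed.

Lemma eball_dist1 {R : realType} (x y : R * R) (r : R) :
  eball x r y -> `|y.1 - x.1| < r.
Proof. by rewrite distrC; apply: le_lt_trans (fst_le_eucl _ _). Qed.

Lemma eball_dist2 {R : realType} (x y : R * R) (r : R) :
  eball x r y -> `|y.2 - x.2| < r.
Proof. by rewrite distrC; apply: le_lt_trans (snd_le_eucl _ _). Qed.

(** * Densities and Jacobian of a locally affine function of slope 1 or -1 *)

Lemma limf_esup_near_cst {R : realType} {F : set_system R}
    (g : R -> \bar R) (c : \bar R) :
  ProperFilter F -> (\forall t \near F, g t = c) -> limf_esup g F = c.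
Proof.
move=> FF gc; rewrite limf_esupE; apply/eqP; rewrite eq_le; apply/andP; split.
  apply: ereal_inf_le; exists (ereal_sup (g @` [set t | g t = c])).
    by exists [set t | g t = c].
  by apply: ge_ereal_sup => _ [t /= -> <-].
apply: le_ereal_inf_tmp => _ [V FV <-].
have [t [Vt gt]] := filter_ex (filterI FV gc).
by rewrite -gt; apply: ereal_sup_ubound; exists t.
Qed.

Lemma limf_einf_near_cst {R : realType} {F : set_system R}
    (g : R -> \bar R) (c : \bar R) :
  ProperFilter F -> (\forall t \near F, g t = c) -> limf_einf g F = c.
Proof.
move=> FF gc; rewrite /limf_einf (limf_esup_near_cst _ (- c)%E) ?oppeK//.
by apply: filterS gc => t /= ->.
Qed.

Lemma near_eq_is_diff {K : realType} {V W : normedModType K}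
    (f g df : V -> W) (x : V) :
  (\forall y \near x, f y = g y) -> is_diff x g df -> is_diff x f df.
Proof.
move=> fg gd.
have dg : differentiable g x by exact: ex_diff.
have fgx : f x = g x by exact: nbhs_singleton fg.
have cdg : continuous ('d g x) by case/diff_locallyP : dg.
have ex : f \o shift x = cst (f x) + 'd g x +o_ 0 id.
  apply/eqaddoP => e e0.
  have /eqaddoP/(_ e e0) := ((diff_locallyP x g).1 dg).2.
  have : \forall h \near 0, f (h + x) = g (h + x).
    have hx : h + x @[h --> (0 : V)] --> x.
      by rewrite -[X in _ --> X]add0r; apply: cvgD; [exact: cvg_id|exact: cvg_cst].
    exact: hx fg.
  by apply: filterS2 => h /= fgh; rewrite !fctE /= fgh fgx.
have df' := diff_unique cdg ex.
apply: DiffDef; first by apply/diff_locallyP; rewrite df'.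
by rewrite df' diff_val.
Qed.

Section LocallyUnitSlope.
Context {R : realType} (f : R * R -> R) (x : R * R) (s rho : R).
Context (s1 : s ^+ 2 = 1) (rho0 : 0 < rho).
Context (fE : forall y : R * R,
  `|y.1 - x.1| < rho -> f y = f x + s * (y.1 - x.1)).

(** The horizontal diameter of the disc already covers the interval. *)
Lemma eball_image (r : R) : 0 < r <= rho -> eball x r `<=` @unit_square R ->
  f @` (eball x r `&` @unit_square R) = `]f x - r, f x + r[%classic.
Proof.
move=> /andP[r0 rrho] rQ.
have s_abs u : `|s * u| = `|u|.
  rewrite normrM (_ : `|s| = 1) ?mul1r//.
  by apply/eqP; rewrite -sqr_norm_eq1 s1.
apply/seteqP; split.
  move=> _ [y [/eball_dist1 yx _] <-].
  rewrite /= in_itv /= (fE y) ?(lt_le_trans yx)//.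
  move: yx; rewrite -s_abs ltr_norml => /andP[? ?]; apply/andP; split; lra.
move=> t /=; rewrite in_itv /= => /andP[t1 t2].
have tr : `|t - f x| < r by rewrite ltr_norml; apply/andP; split; lra.
have ty : eball x r (x.1 + s * (t - f x), x.2).
  rewrite /eball /eucl_dist /= subrr expr0n addr0 opprD addrA subrr sub0r sqrtr_sqr.
  by rewrite normrN s_abs.
exists (x.1 + s * (t - f x), x.2); first by split=> //; exact: rQ.
rewrite (fE (_, _)) /= addrAC subrr add0r ?s_abs ?(lt_le_trans tr)//.
by rewrite mulrA -expr2 s1 mul1r addrC subrK.
Qed.

Lemma density_ratio_eq1 (r : R) :
  0 < r <= rho -> eball x r `<=` @unit_square R ->
  density_ratio f x r = 1%E.
Proof.
move=> /[dup] /andP[r0 _] rr rQ.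
rewrite /density_ratio eball_image// hausdorff_content1_itv; last lra.
rewrite -EFinM; congr (_%:E); rewrite /omega1.
by field; rewrite lt0r_neq0.
Qed.

Lemma locally_affine_is_diff : is_diff x f (s \*: (@fst R R)).
Proof.
have cL : continuous (s \*: (@fst R R) : R * R -> R).
  by move=> p; apply: cvgMl_tmp; exact: cvg_fst.
apply: (@near_eq_is_diff _ _ _ _ (fun y => (f x - s * x.1) + (s \*: (@fst R R)) y)).
  exists (ball x.1 rho, setT).
    by split; [exact: nbhsx_ballx|exact: filterT].
  move=> y [/= yx _]; rewrite (fE y) /=; last by rewrite distrC.
  by rewrite mulrBr addrA addrAC.
apply: is_diff_eq; last exact: add0r.
apply: is_diffD.
apply: DiffDef; first exact: linear_differentiable.
exact: diff_lin.
Qed.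

Lemma locally_affine_jac1 : jac1 f x = 1.
Proof.
rewrite /jac1 det_mx11 !mxE big_ord_recl big_ord1 !mxE /=.
have [_ ->] := locally_affine_is_diff.
by rewrite /= /GRing.scale /= mulr1 !mulr0 addr0 -expr2 s1 sqrtr1.
Qed.

Lemma locally_affine_densities : 0 < x.1 < 1 -> 0 < x.2 < 1 ->
  upper_density f x = 1%E /\ lower_density f x = 1%E.
Proof.
move=> /andP[x10 x11] /andP[x20 x21].
have ratio1 : \forall r \near 0^'+, density_ratio f x r = 1%E.
  have r_small (c : R) : 0 < c -> \forall r \near 0^'+, r < c.
    exact: nbhs_right_lt.
  near=> r.
  have r0 : 0 < r by [].
  apply: density_ratio_eq1.
    by rewrite r0 ltW //; near: r; exact: r_small.
  have rx1 : r < x.1 by near: r; exact: r_small.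
  have rx1' : r < 1 - x.1 by near: r; apply: r_small; rewrite subr_gt0.
  have rx2 : r < x.2 by near: r; exact: r_small.
  have rx2' : r < 1 - x.2 by near: r; apply: r_small; rewrite subr_gt0.
  move=> y yr.
  have /andP[? ?] : - r < y.1 - x.1 < r by rewrite -ltr_norml eball_dist1.
  have /andP[? ?] : - r < y.2 - x.2 < r by rewrite -ltr_norml eball_dist2.
  by split; rewrite /= in_itv /=; apply/andP; split; lra.
by split; [exact: limf_esup_near_cst|exact: limf_einf_near_cst].
Unshelve. all: by end_near.
Qed.

End LocallyUnitSlope.

(** * The folding map *)

Definition triangle_wave {R : realType} (v : R) : R :=
  `|v - (Num.floor v)%:~R - 2^-1|.

Lemma triangle_wave_itv {R : realType} (v : R) : 0 <= triangle_wave v <= 2^-1.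
Proof.
rewrite /triangle_wave normr_ge0 /= ler_norml.
have /andP[v1 v2] := floor_itv v; rewrite intrD in v2.
by apply/andP; split; lra.
Qed.

(** The creases of the wave are the integers and the half-integers, that is the
    [v] for which [v * 2] is an integer. *)
Lemma triangle_wave_locally_affine {R : realType} (v : R) :
  (forall k : int, v * 2 != k%:~R) ->
  exists s rho : R, [/\ s ^+ 2 = 1, 0 < rho &
    forall u, `|u - v| < rho ->
      triangle_wave u = triangle_wave v + s * (u - v)].
Proof.
move=> v2; set m := Num.floor v.
have /andP[mv vm] := floor_itv v; rewrite -/m intrD in mv vm.
have mv' : m%:~R < v.
  rewrite lt_neqAle mv andbT; apply: contra (v2 (m * 2)) => /eqP <-.
  by rewrite intrM.
have waveE (u : R) :
    m%:~R < u < m%:~R + 1 -> triangle_wave u = `|u - m%:~R - 2^-1|.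
  move=> /andP[mu um]; rewrite /triangle_wave (_ : Num.floor u = m) //.
  by apply: floor_def; rewrite intrD (ltW mu).
have vE : triangle_wave v = `|v - m%:~R - 2^-1| by rewrite waveE // mv'.
have [lt|lt|eq] := ltgtP v (m%:~R + 2^-1).
- exists (-1), (Num.min (v - m%:~R) (m%:~R + 2^-1 - v)).
  split; [by rewrite sqrrN expr1n|by rewrite lt_min !subr_gt0 mv'|move=> u].
  rewrite lt_min !ltr_norml => /andP[/andP[? ?] /andP[? ?]].
  rewrite waveE ?vE //; last by apply/andP; split; lra.
  rewrite !ler0_norm; lra.
- exists 1, (Num.min (m%:~R + 1 - v) (v - (m%:~R + 2^-1))).
  split; [by rewrite expr1n|by rewrite lt_min !subr_gt0 vm|move=> u].
  rewrite lt_min !ltr_norml => /andP[/andP[? ?] /andP[? ?]].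
  rewrite waveE ?vE //; last by apply/andP; split; lra.
  rewrite !ger0_norm; lra.
- have /eqP[] := v2 (m * 2 + 1).
  rewrite intrD intrM eq; lra.
Qed.

Definition fold_map {R : realType} (N : R) (p : R * R) : R :=
  triangle_wave (N * p.1) / N.

Lemma fold_map_itv {R : realType} (N : R) (p : R * R) : 0 < N ->
  0 <= fold_map N p <= 2^-1 / N.
Proof.
move=> N0; have /andP[w0 w1] := triangle_wave_itv (N * p.1).
rewrite /fold_map; apply/andP; split; first by rewrite divr_ge0 // ltW.
by rewrite ler_pM2r ?invr_gt0.
Qed.

Lemma fold_map_locally_affine {R : realType} (N : R) (x : R * R) : 0 < N ->
  (forall k : int, x.1 != k%:~R / (N * 2)) ->
  exists s rho : R, [/\ s ^+ 2 = 1, 0 < rho &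
    forall y, `|y.1 - x.1| < rho ->
      fold_map N y = fold_map N x + s * (y.1 - x.1)].
Proof.
move=> N0 xN; have N_neq0 : N != 0 by rewrite gt_eqF.
have [k|s [rho [s1 rho0 wE]]] := @triangle_wave_locally_affine R (N * x.1).
  by apply: contra (xN k) => /eqP <-; apply/eqP; field.
exists s, (rho / N); split=> [//||y yx]; first by rewrite divr_gt0.
rewrite /fold_map wE; first by field.
by rewrite -mulrBr normrM gtr0_norm // mulrC -ltr_pdivlMr.
Qed.

(** * Regularity of planar Lebesgue measure *)

Lemma lebesgue2X {R : realType} (A B : set (measurableTypeR R)) :
  measurable A -> measurable B ->
  lebesgue2 (A `*` B) = (lebesgue_measure A * lebesgue_measure B)%E.
Proof. exact: product_measure1E. Qed.

Lemma lebesgue2U {R : realType}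
    (A B : set (measurableTypeR R * measurableTypeR R)) :
  measurable A -> measurable B ->
  (@lebesgue2 R (A `|` B) <= @lebesgue2 R A + @lebesgue2 R B)%E.
Proof. exact: measureU2. Qed.

Lemma openX {T U : topologicalType} (A : set T) (B : set U) :
  open A -> open B -> open (A `*` B).
Proof.
move=> oA oB; rewrite (_ : A `*` B = (fst @^-1` A) `&` (snd @^-1` B)) //.
apply: openI; apply: open_comp => // x _; [exact: cvg_fst|exact: cvg_snd].
Qed.

Lemma closedX {T U : topologicalType} (A : set T) (B : set U) :
  closed A -> closed B -> closed (A `*` B).
Proof.
move=> cA cB; rewrite (_ : A `*` B = (fst @^-1` A) `&` (snd @^-1` B)) //.
apply: closedI; apply: closed_comp => // x _; [exact: cvg_fst|exact: cvg_snd].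
Qed.

Lemma ae_off_lines {R : realType} (C : set R) : countable C ->
  {ae @lebesgue2 R, forall x, ~ C x.1 /\ ~ C x.2}.
Proof.
move=> cC; have mC : measurable C by exact: countable_measurable.
exists ((C `*` setT) `|` (setT `*` C)); split.
- by apply: measurableU; exact: measurableX.
- apply/eqP; rewrite -measure_le0; apply: (le_trans (lebesgue2U _ _ _ _)).
  + exact: measurableX.
  + exact: measurableX.
  + by rewrite !lebesgue2X//= countable_lebesgue_measure0 // mul0e mule0 adde0.
- move=> x /= /not_andP[/contrapT|/contrapT] Cx; [by left|by right].
Qed.

Section Regularity.
Context {R : realType}.
Local Notation mR := (measurableTypeR R).
Local Notation plane := (R * R)%type.
Local Notation unit_itv := (`[0, 1]%classic : set R).

(** Outer regularity applied to [A] and to its complement. The complement of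
    the unit interval is added to the open sets because outer regularity
    concerns sets of finite measure. *)
Lemma borel_approx1 (A : set R) (e : R) : measurable A -> 0 < e ->
  exists F U : set R, [/\ closed F, open U, F `<=` A, A `<=` U &
    (lebesgue_measure (unit_itv `&` (U `\` F)) <= e%:E)%E].
Proof.
move=> mA e0.
have outer (B : set R) : measurable B -> exists U : set R, [/\ open U, B `<=` U &
    (lebesgue_measure (unit_itv `&` (U `\` B)) <= (e / 2)%:E)%E].
  move=> mB; have mBI : measurable (B `&` unit_itv) by apply: measurableI.
  have BIoo : (lebesgue_measure (B `&` unit_itv) < +oo)%E.
    apply: (@le_lt_trans _ _ (lebesgue_measure unit_itv)).
      by apply: le_measure; rewrite ?inE.
    by rewrite lebesgue_measure_itv /= lte_fin ltr01 ltry.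
  have [|U [oU BU Ue]] := lebesgue_regularity_outer mBI BIoo (eps := e / 2).
    by rewrite divr_gt0.
  have mU := open_measurable oU.
  have oI : open (~` unit_itv) by apply: closed_openC; exact: itv_closed.
  exists (U `|` ~` unit_itv); split; first exact: openU.
    move=> x Bx; have [xI|xI] := pselect (unit_itv x); [left|by right].
    by apply: BU.
  apply: le_trans (ltW Ue); apply: le_measure; rewrite ?inE.
  - apply: measurableI => //; apply: measurableD => //.
    by apply: open_measurable; exact: openU.
  - exact: measurableD.
  - by move=> x [xI [[Ux|//] nBx]]; split=> // -[].
have [U [oU AU Ue]] := outer A mA.
have [V [oV AV Ve]] := outer _ (measurableC mA).
exists (~` V), U; split => //; first exact: open_closedC.
  by move=> x nVx; apply: contrapT => /AV.
have mU := open_measurable oU; have mV := open_measurable oV.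
rewrite (_ : unit_itv `&` (U `\` ~` V) =
    (unit_itv `&` (U `\` A)) `|` (unit_itv `&` (V `\` ~` A))).
  rewrite [e]splitr EFinD.
  apply: le_trans (leeD Ue Ve); apply: measureU2; apply: measurableI => //.
    exact: measurableD.
  by apply: measurableD => //; exact: measurableC.
apply/seteqP; split=> x; rewrite /setD /=.
  move=> [xI [Ux /contrapT Vx]]; have [Ax|nAx] := pselect (A x).
    by right; split=> //; split=> // nAx.
  by left.
move=> [[xI [Ux nAx]]|[xI [Vx /contrapT Ax]]]; split=> //.
  by split=> // nVx; apply: nVx; apply: AV.
by split; [exact: AU|move=> nVx].
Qed.

(** Squeezing between a closed and an open set makes this class closed under
    complement. Measurability of the two sets is a clause of its own since the
    sigma-algebra of the product comes from rectangles, not from open sets. *)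
Definition regular_set (B : set plane) :=
  forall e : R, 0 < e -> exists F U : set plane,
    [/\ closed F /\ open U,
        measurable (F : set (mR * mR)) /\ measurable (U : set (mR * mR)),
        F `<=` B, B `<=` U &
        (@lebesgue2 R (@unit_square R `&` (U `\` F)) <= e%:E)%E].

Lemma measurable_unit_square : measurable (@unit_square R : set (mR * mR)).
Proof. by apply: measurableX. Qed.

Lemma lebesgue2_unit_square : lebesgue2 (@unit_square R) = 1%E.
Proof.
rewrite lebesgue2X //= lebesgue_measure_itv /= lte_fin ltr01.
by rewrite -EFinB subr0 mule1.
Qed.

Lemma regular_setX (A B : set R) :
  measurable A -> measurable B -> regular_set (A `*` B).
Proof.
move=> mA mB e e0.
have e20 : 0 < e / 2 by rewrite divr_gt0.
have [F [U [cF oU FA AU FUe]]] := borel_approx1 A _ mA e20.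
have [G [V [cG oV GB BV GVe]]] := borel_approx1 B _ mB e20.
have mF := closed_measurable cF; have mG := closed_measurable cG.
have mU := open_measurable oU; have mV := open_measurable oV.
exists (F `*` G), (U `*` V); split.
- by split; [exact: closedX|exact: openX].
- by split; exact: measurableX.
- by move=> x [/FA ? /GB ?].
- by move=> x [/AU ? /BV ?].
pose S := ((unit_itv `&` (U `\` F)) `*` unit_itv) `|`
  (unit_itv `*` (unit_itv `&` (V `\` G))).
have m1 : measurable ((unit_itv `&` (U `\` F)) `*` unit_itv : set (mR * mR)).
  by apply: measurableX => //; apply: measurableI => //; exact: measurableD.
have m2 : measurable (unit_itv `*` (unit_itv `&` (V `\` G)) : set (mR * mR)).
  by apply: measurableX => //; apply: measurableI => //; exact: measurableD.
apply: (@le_trans _ _ (lebesgue2 S)).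
  apply: le_measure; rewrite ?inE.
  - apply: measurableI; first exact: measurable_unit_square.
    by apply: measurableD; exact: measurableX.
  - exact: measurableU.
  - move=> x [[xI yI] [[Ux Vx] nFG]]; have [Fx|nFx] := pselect (F x.1).
      by right; split=> //; split=> //; split=> // Gx; apply: nFG.
    by left.
apply: (le_trans (lebesgue2U _ _ m1 m2)).
rewrite !lebesgue2X /=; first last.
- by [].
- by apply: measurableI => //; exact: measurableD.
- by apply: measurableI => //; exact: measurableD.
- by [].
rewrite lebesgue_measure_itv /= lte_fin ltr01 -EFinB subr0 mule1 mul1e.
by rewrite [e]splitr EFinD; exact: leeD.
Qed.

(** For a countable union, the union of the closed sets need not be closed: it is
    cut to a finite union, which loses little because the unit square has finite
    measure. *)
Lemma regular_sigma_algebra : sigma_algebra setT regular_set.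
Proof.
split.
- move=> e e0; exists set0, set0; split=> //.
  + by split; [exact: closed0|exact: open0].
  + by rewrite setD0 setI0 /lebesgue2 measure0 lee_fin ltW.
- move=> A rA e e0; have [F [U [[cF oU] [mF mU] FA AU FUe]]] := rA e e0.
  exists (~` U), (~` F); rewrite setTD; split.
  + by split; [exact: open_closedC|exact: closed_openC].
  + by split; exact: measurableC.
  + exact: subsetC.
  + exact: subsetC.
  + by rewrite setDE setCK setIC (setIC (~` F)) -setDE setIC.
move=> A rA e e0.
have e2 n : 0 < e / 2 / (2 ^ n.+1)%:R by rewrite !divr_gt0 // ltr0n expn_gt0.
have /choice[F /choice[U FU]] := fun n => rA n _ (e2 n).
pose Q := @unit_square R.
have mQ : measurable (Q : set (mR * mR)) by exact: measurable_unit_square.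
have mF n : measurable (F n : set (mR * mR)) by case: (FU n) => _ [].
have mU n : measurable (U n : set (mR * mR)) by case: (FU n) => _ [].
pose FN n := \big[setU/set0]_(k < n) F k.
have mFN n : measurable (FN n : set (mR * mR)) by apply: bigsetU_measurable.
have mFoo : measurable (\bigcup_n F n : set (mR * mR)) by exact: bigcup_measurable.
have mUoo : measurable (\bigcup_n U n : set (mR * mR)) by exact: bigcup_measurable.
pose G n := Q `&` (\bigcup_n F n `\` FN n).
have mG n : measurable (G n : set (mR * mR)).
  by apply: measurableI => //; exact: measurableD.
have G0 : \bigcap_n G n = set0.
  apply/seteqP; split=> // x Gx; have [_ [[k _ Fkx] _]] := Gx 0%N I.
  have [_ [_]] := Gx k.+1 I; apply.
  by rewrite /FN -bigcup_mkord; exists k => /=.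
have [n Gn] : exists n, (@lebesgue2 R (G n) < (e / 2)%:E)%E.
  have G_lt : (@lebesgue2 R (G 0%N) < +oo)%E.
    apply: (@le_lt_trans _ _ (lebesgue2 Q)); last by rewrite lebesgue2_unit_square ltry.
    by apply: le_measure; rewrite ?inE //; exact: subIsetl.
  have mG0 : measurable (\bigcap_n G n : set (mR * mR)) by rewrite G0.
  have G_decr : {homo G : n m / (n <= m)%N >-> (m <= n)%O}.
    move=> i j ij; apply/subsetPset => x [Qx [Fx nFN]]; split=> //; split=> // FNx.
    by apply: nFN; exact: subset_bigsetU FNx.
  have := @nonincreasing_cvg_mu _ _ _ (@lebesgue2 R) G G_lt mG mG0 G_decr.
  rewrite G0 measure0 => /fine_cvgP[Gfin].
  move=> /(_ [set x | x < e / 2]) [|n _ Gn].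
    by apply: open_nbhs_nbhs; split; [exact: open_lt|rewrite /= divr_gt0].
  have [m _ Gm] := Gfin.
  exists (maxn n m).
  have := Gn (maxn n m) (leq_maxl _ _); rewrite /= -lte_fin fineK //.
  exact: Gm (leq_maxr _ _).
exists (FN n), (\bigcup_n U n); split.
- split; last by apply: bigcup_open => k _; case: (FU k) => -[].
  by apply: closed_bigsetU => k _; case: (FU k) => -[].
- by [].
- rewrite /FN -bigcup_mkord => x [k _ Fkx]; exists k => //.
  by case: (FU k) => _ _ FA _ _; exact: FA.
- by move=> x [k _ Akx]; exists k => //; case: (FU k) => _ _ _ AU _; exact: AU.
pose D k := Q `&` (U k `\` F k).
have mD k : measurable (D k : set (mR * mR)).
  by apply: measurableI => //; exact: measurableD.
have mDoo : measurable (\bigcup_k D k : set (mR * mR)) by exact: bigcup_measurable.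
apply: (@le_trans _ _ (@lebesgue2 R ((\bigcup_k D k) `|` G n))).
  apply: le_measure; rewrite ?inE.
  - by apply: measurableI => //; exact: measurableD.
  - exact: measurableU.
  - move=> x [Qx [[k _ Ukx] nFN]].
    have [Foox|nFoo] := pselect ((\bigcup_n F n) x); first by right.
    by left; exists k => //; split=> //; split=> // Fkx; apply: nFoo; exists k.
apply: (le_trans (lebesgue2U _ _ mDoo (mG n))).
rewrite [e]splitr EFinD; apply: leeD; last exact: ltW.
apply: le_trans (measure_sigma_subadditive _ mD mDoo (@subset_refl _ _)) _.
apply: le_trans (epsilon_trick0 xpredT _); last by rewrite ltW // divr_gt0.
by apply: lee_nneseries => [k _ _|k _]; [exact: measure_ge0|case: (FU k)].
Qed.

Lemma measurable_regular (B : set (mR * mR)) : measurable B -> regular_set B.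
Proof.
rewrite measurable_prod_measurableType.
apply: smallest_sub; first exact: regular_sigma_algebra.
by move=> _ [A mA [C mC <-]]; exact: regular_setX.
Qed.

Lemma H2_le (A B : set plane) : A `<=` B ->
  (H2 A <= H2 B)%E.
Proof. exact: le_mu_ext. Qed.

Lemma H2_measurable (B : set (mR * mR)) : measurable B -> H2 B = lebesgue2 B.
Proof. exact: measurable_mu_extE. Qed.

(** The outer measure is an infimum over Borel coverings; measurable_regular turns
    an almost optimal one into an open set. *)
Lemma H2_outer_open (A : set plane) (e : R) : 0 < e -> A `<=` @unit_square R ->
  exists U : set plane,
    [/\ open U, A `<=` U & (H2 (@unit_square R `&` U) <= H2 A + e%:E)%E].
Proof.
move=> e0 AQ; pose Q := @unit_square R.
have mQ := measurable_unit_square.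
have HAQ : (H2 A <= 1)%E.
  by rewrite -lebesgue2_unit_square -(H2_measurable _ mQ); exact: H2_le.
have HA0 : (0 <= H2 A)%E by exact: mu_ext_ge0.
have HAfin : H2 A \is a fin_num.
  by rewrite ge0_fin_numE // (le_lt_trans HAQ) ?ltry.
have e20 : 0 < e / 2 by rewrite divr_gt0.
have [_ [F [mF AF] <-] Fe] := lb_ereal_inf_adherent e20 HAfin.
pose B : set (mR * mR) := \bigcup_k F k.
have mB : measurable B by exact: bigcup_measurable.
have [E [U [[_ oU] [mE mU] EB BU UEe]]] := measurable_regular B mB _ e20.
exists U; split=> //; first exact: subset_trans AF BU.
have mQU : measurable (Q `&` U : set (mR * mR)) by exact: measurableI.
have mQUE : measurable (Q `&` (U `\` E) : set (mR * mR)).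
  by apply: measurableI => //; exact: measurableD.
rewrite (H2_measurable _ mQU).
apply: (@le_trans _ _ (@lebesgue2 R (B `|` (Q `&` (U `\` E))))).
  apply: le_measure; rewrite ?inE //; first exact: measurableU.
  move=> x [Qx Ux]; have [Bx|nBx] := pselect (B x); [by left|right].
  by split=> //; split=> // /EB.
apply: (le_trans (lebesgue2U _ _ mB mQUE)).
rewrite [e in leRHS]splitr EFinD (addeA (H2 A)); apply: leeD; last exact: UEe.
apply: le_trans (ltW Fe).
exact: measure_sigma_subadditive.
Qed.

(** Remove from the square an open neighbourhood of its part outside [K]. The
    Caratheodory condition, tested on the square, makes the outer measures of [K]
    and of that part add up, so that what remains is nearly all of [K]. *)
Lemma caratheodory_inner_compact (K : set plane) (e : R) :
  lebesgue2_measurable K -> K `<=` @unit_square R -> 0 < e ->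
  exists C : set plane, [/\ compact C, C `<=` K & (H2 K <= H2 C + e%:E)%E].
Proof.
move=> mK KQ e0; pose Q := @unit_square R.
have mQ := measurable_unit_square.
have [U [oU KU Ue]] := H2_outer_open (Q `&` ~` K) e e0 (@subIsetl _ _ _).
exists (Q `&` ~` U); split.
- apply: compact_closedI; last exact: open_closedC.
  by apply: compact_setX; exact: segment_compact.
- by move=> x [Qx nUx]; apply: contrapT => nKx; exact/nUx/KU.
have HQ (A : set plane) : A `<=` Q -> H2 A \is a fin_num.
  move=> AQ; rewrite ge0_fin_numE; last exact: mu_ext_ge0.
  apply: (@le_lt_trans _ _ (H2 Q)); first exact: H2_le.
  by rewrite H2_measurable // lebesgue2_unit_square ltry.
have split_K : H2 Q = (H2 K + H2 (Q `&` ~` K))%E.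
  by rewrite [LHS]mK (_ : Q `&` K = K) //; exact/setIidPr.
have split_U : (H2 Q <= H2 (Q `&` ~` U) + H2 (Q `&` U))%E.
  apply: le_trans (outer_measureU2 (mu_ext (@lebesgue2 R)) _ _).
  apply: H2_le => x Qx; have [Ux|nUx] := pselect (U x); [by right|by left].
rewrite -(@leeD2rE _ (H2 (Q `&` ~` K))); last by apply: HQ; exact: subIsetl.
rewrite -split_K -(addeA (H2 _)) [(e%:E + _)%E]addeC.
exact: le_trans split_U (leeD2l _ Ue).
Qed.

End Regularity.

(** * Area of a compact set with thin slices *)

(** On the compact set of pairs of points of [C] with [w <= `|u p - u q|], the
    function [`|v p - v q|] does not vanish, hence stays away from 0. *)
Lemma compact_slices_uniform {R : realType} {T : topologicalType} (C : set T)
    (u v : T -> R) (w : R) :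
  compact C -> continuous u -> continuous v ->
  (forall p q, C p -> C q -> v p = v q -> `|u p - u q| < w) ->
  exists2 h : R, 0 < h &
    forall p q, C p -> C q -> `|v p - v q| < h -> `|u p - u q| < w.
Proof.
move=> cptC cu cv slice.
have cdiff (g : T -> R) :
    continuous g -> continuous (fun z : T * T => `|g z.1 - g z.2|).
  move=> cg z; apply: cvg_norm; apply: cvgB.
    by apply: (continuous_cvg _ (cg _)); exact: cvg_fst.
  by apply: (continuous_cvg _ (cg _)); exact: cvg_snd.
pose D := (C `*` C) `&` [set z | w <= `|u z.1 - u z.2|].
have cptD : compact D.
  apply: compact_closedI; first exact: compact_setX.
  apply: (@closed_comp _ _ (fun z : T * T => `|u z.1 - u z.2|) [set r | w <= r]).
    by move=> z _; exact: cdiff.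
  exact: closed_ge.
have closed_im : closed ((fun z : T * T => `|v z.1 - v z.2|) @` D).
  apply: compact_closed; first exact: Rhausdorff.
  by apply: continuous_compact => //; apply: continuous_subspaceT; exact: cdiff.
have /(_ 0) := closed_openC closed_im.
rewrite /interior /= => near0.
have /near0/nbhs_ballP[h /= h0 hD] :
    (~` ((fun z : T * T => `|v z.1 - v z.2|) @` D)) (0 : R).
  move=> [[p q] /= [[/= Cp Cq] wpq] /eqP]; rewrite normr_eq0 subr_eq0 => /eqP vpq.
  by move: (slice p q Cp Cq vpq); rewrite ltNge wpq.
exists h => // p q Cp Cq vh; rewrite ltNge; apply/negP => wpq.
apply: (hD `|v p - v q|); last by exists (p, q).
by rewrite /ball /= sub0r normrN normr_id.
Qed.

Section Covering.
Context {R : realType}.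
Local Notation plane := (R * R)%type.

Lemma H2U_le (A B : set plane) : (H2 (A `|` B) <= H2 A + H2 B)%E.
Proof. exact: outer_measureU2 (mu_ext (@lebesgue2 R)) _ _. Qed.

Lemma H2_set0 : H2 (@set0 plane) = 0%E.
Proof. by rewrite (H2_measurable set0) // /lebesgue2 measure0. Qed.

(** Used both to cut a set into horizontal strips and to cut a strip into
    squares, with [phi] a coordinate of [G]. *)
Lemma H2_slices (A : set plane) (phi : plane -> R) (a h c : R) (n : nat) :
  0 < h ->
  (forall p, A p -> a <= phi p < a + n%:R * h) ->
  (forall b, H2 (A `&` [set p | (b <= phi p < b + h)%R]) <= c%:E)%E ->
  (H2 A <= (n%:R * c)%:E)%E.
Proof.
move=> h0; elim: n A a => [|n IH] A a Aphi Ac.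
  rewrite (_ : A = set0) ?H2_set0 ?mul0r// -subset0 => p /Aphi.
  by rewrite mul0r addr0 => /andP[ap pa]; move: (le_lt_trans ap pa); rewrite ltxx.
pose A' := A `&` [set p | a + h <= phi p].
apply: (@le_trans _ _ (H2 A' + H2 (A `&` [set p | (a <= phi p < a + h)%R]))%E).
  apply: le_trans (H2U_le _ _); apply: H2_le => p Ap.
  have /andP[ap _] := Aphi p Ap.
  by have [ph|hp] := ltP (phi p) (a + h); [right; split=> //=; rewrite ap|left].
rewrite -natr1 mulrDl mul1r EFinD; apply: leeD; last exact: Ac.
apply: (IH A' (a + h)) => [p [Ap /= ->]|b].
  have /andP[_] := Aphi p Ap; rewrite -natr1 mulrDl mul1r; lra.
apply: le_trans (Ac b); apply: H2_le => p [[Ap _] bp]; by split.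
Qed.

Lemma H2_diameter (A : set plane) (d : R) : 0 <= d ->
  (forall p q, A p -> A q -> eucl_dist p q <= d) ->
  (H2 A <= ((2 * d) ^+ 2)%:E)%E.
Proof.
move=> d0 Ad; have [->|/set0P[p Ap]] := eqVneq A set0.
  by rewrite H2_set0 lee_fin sqr_ge0.
pose I (t : R) := `[t - d, t + d]%classic : set (measurableTypeR R).
have mI t : measurable (I t) by exact: measurable_itv.
have lI t : lebesgue_measure (I t) = (2 * d)%:E.
  rewrite /I lebesgue_measure_itv /= lte_fin; case: ltP => dd; last first.
    by congr (_%:E); lra.
  by rewrite -EFinB; congr (_%:E); lra.
apply: (@le_trans _ _ (H2 (I p.1 `*` I p.2))).
  apply: H2_le => q Aq; split; rewrite /I /= in_itv /= -ler_distl.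
    exact: le_trans (fst_le_eucl _ _) (Ad _ _ Aq Ap).
  exact: le_trans (snd_le_eucl _ _) (Ad _ _ Aq Ap).
rewrite H2_measurable; last exact: measurableX.
by rewrite lebesgue2X // !lI -EFinM expr2.
Qed.

Lemma exists_natural_multiple (l h : R) : 0 <= l -> 0 < h ->
  exists n : nat, l < n%:R * h <= l + h.
Proof.
move=> l0 h0; exists (Num.truncn (l / h)).+1.
have /andP[t1 t2] := truncn_itv (divr_ge0 l0 (ltW h0)).
rewrite ler_pdivlMr// in t1; rewrite ltr_pdivrMr// in t2.
by rewrite t2 /= -natr1 mulrDl mul1r lerD2r.
Qed.

(** A square of side [h] has diameter at most [2 * h], so its preimage under [G]
    has diameter at most [L * (2 * h)] and outer measure at most
    [16 * L ^+ 2 * h ^+ 2]. A strip needs at most [(2 * w + h) / h] squares, since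
    it lies within [w] of any of its points, and there are at most
    [(2 * M + h) / h] strips for the same reason. *)
Lemma H2_thin_slices (C : set plane) (G : plane -> plane) (L M w h : R) :
  0 < L -> 0 <= M -> 0 <= w -> 0 < h ->
  (forall p q, C p -> C q -> eucl_dist p q <= L * eucl_dist (G p) (G q)) ->
  (forall p q, C p -> C q -> `|(G p).2 - (G q).2| <= M) ->
  (forall p q, C p -> C q ->
    `|(G p).2 - (G q).2| < h -> `|(G p).1 - (G q).1| <= w) ->
  (H2 C <= (16 * L ^+ 2 * ((2 * M + h) * (2 * w + h)))%:E)%E.
Proof.
move=> L0 M0 w0 h0 GL GM Gw.
have near_lt (b x y : R) : b <= x < b + h -> b <= y < b + h -> `|x - y| < h.
  by move=> /andP[? ?] /andP[? ?]; rewrite ltr_norml; apply/andP; split; lra.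
have [|n1 /andP[n1w n1h]] := @exists_natural_multiple (2 * w) h _ h0; first lra.
have [|n2 /andP[n2M n2h]] := @exists_natural_multiple (2 * M) h _ h0; first lra.
pose strip b := C `&` [set p | b <= (G p).2 < b + h].
have cell b a : (H2 (strip b `&` [set p | (a <= (G p).1 < a + h)%R])
    <= ((2 * (L * (2 * h))) ^+ 2)%:E)%E.
  apply: H2_diameter; first by rewrite !mulr_ge0 // ltW.
  move=> p q [[Cp p2] p1] [[Cq q2] q1].
  apply: le_trans (GL p q Cp Cq) _; rewrite ler_pM2l//.
  apply: le_trans (eucl_le_add _ _) _.
  have := near_lt _ _ _ p1 q1; have := near_lt _ _ _ p2 q2; lra.
have H2_strip b : (H2 (strip b) <= (n1%:R * (2 * (L * (2 * h))) ^+ 2)%:E)%E.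
  have [->|/set0P[p [Cp p2]]] := eqVneq (strip b) set0.
    by rewrite H2_set0 lee_fin mulr_ge0// sqr_ge0.
  apply: (@H2_slices _ (fun q => (G q).1) ((G p).1 - w) h) => // q [Cq q2].
  have := Gw q p Cq Cp (near_lt _ _ _ q2 p2).
  rewrite ler_norml => /andP[? ?]; apply/andP; split; lra.
have [->|/set0P[p Cp]] := eqVneq C set0.
  by rewrite H2_set0 lee_fin !mulr_ge0 ?sqr_ge0 ?addr_ge0 ?mulr_ge0// ltW.
apply: (@le_trans _ _ (n2%:R * (n1%:R * (2 * (L * (2 * h))) ^+ 2))%:E).
  apply: (@H2_slices _ (fun q => (G q).2) ((G p).2 - M) h) => // q Cq.
  have := GM q p Cq Cp.
  rewrite ler_norml => /andP[? ?]; apply/andP; split; lra.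
rewrite lee_fin.
rewrite (_ : n2%:R * _ = 16 * L ^+ 2 * ((n2%:R * h) * (n1%:R * h))); last by ring.
apply: ler_wpM2l; first by rewrite mulr_ge0 // sqr_ge0.
by apply: ler_pM => //; rewrite mulr_ge0 // ltW.
Qed.

End Covering.

(** * The counterexample *)

Lemma ae_fold_map {R : realType} (n : nat) : (0 < n)%N ->
  {ae @lebesgue2 R, forall x, @unit_square R x ->
     [/\ upper_density (fold_map n%:R) x = 1%E,
         lower_density (fold_map n%:R) x = 1%E,
         differentiable (fold_map n%:R) x & jac1 (fold_map n%:R) x = 1]}.
Proof.
(* The grid contains 0 and 1, so that avoiding it with both coordinates also
   puts the point in the interior of the square. *)
move=> n0; pose grid := range (fun k : int => k%:~R / (n%:R * 2) : R).
have N0 : 0 < n%:R :> R by rewrite ltr0n.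
have grid0 : grid 0 by exists 0 => //; rewrite mul0r.
have grid1 : grid 1.
  exists (n * 2)%N => //.
  by rewrite -[_%:~R]/((n * 2)%:R) natrM divff // mulf_neq0 // gt_eqF.
have grid_countable : countable grid.
  exact: sub_countable (card_image_le _ _) (countableP _).
have in01 (t : R) : t \in `[0, 1] -> ~ grid t -> 0 < t < 1.
  rewrite in_itv /= !le_eqVlt => /andP[/orP[/eqP <-//|->] /orP[/eqP ->//|->]] //.
apply: negligibleS (ae_off_lines _ grid_countable) => x; apply: contra_not.
move=> [gx1 gx2] [/= x1 x2].
have [|s [rho [s1 rho0 fE]]] := @fold_map_locally_affine R n%:R x N0.
  by move=> k; apply/eqP => xk; apply: gx1; exists k.
have [-> ->] := locally_affine_densities _ _ _ _ s1 rho0 fE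
  (in01 _ x1 gx1) (in01 _ x2 gx2).
split=> //; last exact: locally_affine_jac1 fE.
by have [] := locally_affine_is_diff _ _ _ _ rho0 fE.
Qed.

Theorem proposition5p3 (R : realType) (Lambda : R) (hLambda : 1 < Lambda)
    (eps : R) (heps : 0 < eps) :
  exists f : R * R -> R,
    {ae @lebesgue2 R, forall x, unit_square x ->
       [/\ upper_density f x = 1%E, lower_density f x = 1%E,
           differentiable f x & jac1 f x = 1]} /\
    forall (K : set (R * R)) (G Ginv : R * R -> R * R),
      lebesgue2_measurable K -> K `<=` @unit_square R ->
      cancel G Ginv -> cancel Ginv G ->
      bilipschitz_homeo Lambda (@eucl_dist R) (@eucl_dist R) setT setT G ->
      (forall y : R,
         let S := horizontal_line y `&` G @` K in
         bilipschitz_homeo Lambda (@eucl_dist R) (@rdist R)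
           S ((f \o Ginv) @` S) (f \o Ginv)) ->
      (H2 K < eps%:E)%E.
Proof.
have L0 : 0 < Lambda by apply: lt_trans hLambda.
(* 400 is 16 * 5 * 5, with the 16 of H2_thin_slices, where [2 * M] will be
   [4 * Lambda], [2 * w] will be [4 * Lambda * d], and [h <= d] is at most both
   [Lambda] and [Lambda * d]. *)
have [n n0 n_eps] : exists2 n : nat,
    (0 < n)%N & 400 * Lambda ^+ 4 * (2^-1 / n%:R) < eps.
  exists (Num.truncn (200 * Lambda ^+ 4 / eps)).+1 => //.
  have L4 : 0 <= 200 * Lambda ^+ 4 by rewrite mulr_ge0 // exprn_ge0 // ltW.
  have /andP[_] := truncn_itv (divr_ge0 L4 (ltW heps)).
  rewrite ltr_pdivrMr // => lt_eps.
  rewrite mulrA ltr_pdivrMr ?ltr0n // [eps * _]mulrC; apply: le_lt_trans lt_eps; lra.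
have N0 : 0 < n%:R :> R by rewrite ltr0n.
set d : R := 2^-1 / n%:R in n_eps.
have d0 : 0 < d by rewrite divr_gt0.
exists (fold_map n%:R); split; first exact: ae_fold_map.
move=> K G Ginv mK KQ GK _ [[_ cG _] bG] slices.
have {cG} cG : continuous G by apply/continuous_subspace_setT.
have LG p q : eucl_dist p q <= Lambda * eucl_dist (G p) (G q).
  have /andP[+ _] := bG p q I I.
  by rewrite -ler_pdivlMl ?invr_gt0 // invrK.
have GL p q : eucl_dist (G p) (G q) <= Lambda * eucl_dist p q.
  by have /andP[] := bG p q I I.
(* The slices of [G @` K] have diameter at most [Lambda * d]; the factor 2 makes
   the inequality strict, as compact_slices_uniform requires. *)
have K_slice p q : K p -> K q -> (G p).2 = (G q).2 ->
    `|(G p).1 - (G q).1| < 2 * Lambda * d.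
  move=> Kp Kq eq2; apply: le_lt_trans (fst_le_eucl _ _) _.
  have [_ bf] := slices (G q).2.
  have /andP[+ _] := bf (G p) (G q)
    (conj (conj I eq2) (ex_intro2 _ _ p Kp erefl))
    (conj (conj I erefl) (ex_intro2 _ _ q Kq erefl)).
  rewrite /rdist /= !GK.
  have /andP[fp0 fpd] := @fold_map_itv R n%:R p N0.
  have /andP[fq0 fqd] := @fold_map_itv R n%:R q N0.
  rewrite -/d in fpd fqd.
  rewrite mulrC ler_pdivrMr // => le_eucl; apply: le_lt_trans le_eucl _.
  rewrite mulrC -mulrA [ltRHS]mulrCA ltr_pM2l//.
  apply: (@le_lt_trans _ _ d); last lra.
  by rewrite ler_norml; apply/andP; split; lra.
suff H2K_le (e : R) : 0 < e -> (H2 K <= (400 * Lambda ^+ 4 * d)%:E + e%:E)%E.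
  apply: le_lt_trans (_ : (H2 K <= (400 * Lambda ^+ 4 * d)%:E)%E) _;
    last by rewrite lte_fin.
  by apply/lee_addgt0Pr => e; exact: H2K_le.
move=> e0; have [C [cptC CK KC]] := caratheodory_inner_compact K e mK KQ e0.
apply: le_trans KC _; rewrite leeD2r //.
have cG1 : continuous (fun p => (G p).1).
  by move=> p; apply: (cvg_comp _ _ (cG p)); exact: cvg_fst.
have cG2 : continuous (fun p => (G p).2).
  by move=> p; apply: (cvg_comp _ _ (cG p)); exact: cvg_snd.
have [|h h0 Gh] := compact_slices_uniform C _ _ (2 * Lambda * d) cptC cG1 cG2.
  by move=> p q Cp Cq; apply: K_slice; exact: CK.
pose h' := Num.min h d.
have h'0 : 0 < h' by rewrite lt_min h0 d0.
have h'd : h' <= d by rewrite ge_min lexx orbT.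
have d1 : d <= 1.
  rewrite /d ler_pdivrMr // mul1r (@le_trans _ _ 1) ?ler1n //; lra.
apply: (@le_trans _ _ (16 * Lambda ^+ 2 *
    ((2 * (2 * Lambda) + h') * (2 * (2 * Lambda * d) + h')))%:E).
  apply: (@H2_thin_slices _ _ G) => //.
  - by rewrite mulr_ge0// ltW.
  - by rewrite !mulr_ge0// ltW.
  - move=> p q Cp Cq; apply: le_trans (snd_le_eucl _ _) _.
    apply: le_trans (GL p q) _; rewrite [2 * _]mulrC ler_pM2l //.
    apply: le_trans (eucl_le_add _ _) _.
    have [] := KQ _ (CK _ Cp); have [] := KQ _ (CK _ Cq).
    rewrite /= !in_itv /= => /andP[? ?] /andP[? ?] /andP[? ?] /andP[? ?].
    rewrite [2]/(1 + 1); apply: lerD; rewrite ler_norml; apply/andP; split; lra.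
  - move=> p q Cp Cq Gpq; apply: ltW; apply: Gh => //.
    by apply: lt_le_trans Gpq _; rewrite ge_min lexx.
rewrite lee_fin.
rewrite (_ : 400 * _ * d =
  16 * Lambda ^+ 2 * ((5 * Lambda) * (5 * Lambda * d))); last by ring.
have Ld : d <= Lambda * d by rewrite ler_peMl // ltW.
have L2 : 0 <= 16 * Lambda ^+ 2 by rewrite mulr_ge0 // sqr_ge0.
have Ld0 : 0 <= Lambda * d by rewrite mulr_ge0 // ltW.
apply: ler_wpM2l => //; apply: ler_pM; lra.
Qed.
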